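(* Let $(T,X,\pi)$ be a topologically weakly-mixing flow on a non-singleton Polish space $X$ with $T$ a topological group. Then it is densely Li-Yorke chaotic.
   Context: A topological flow $(T,X,\pi)$ consists of a topological group $T$ (not necessarily discrete), a topological space $X$ and a jointly continuous action $\pi\colon T\times X\to X$, $(t,x)\mapsto tx$, with $s(tx)=(st)x$ and $ex=x$, where $e$ is the neutral element. For nonempty open $U,V\subseteq X$ let $N_T(U,V)=\{t\in T : U\cap t^{-1}V\neq\emptyset\}$, $t^{-1}V=\{x : tx\in V\}$. The flow is topologically weakly-mixing if $N_T(U,V)\cap N_T(U',V')\neq\emptyset$ for all nonempty open $U,V,U',V'\subseteq X$ (equivalently, $(T,X\times X)$, with $t(x,y)=(tx,ty)$, is topologically transitive). The Polish space $X$ is regarded as a metric space $(X,d)$ with a compatible complete metric $d$. For an increasing sequence $\mathcal{F}=\{F_n\}_{n\ge1}$ of compact subsets of $T$, a set $S\subseteq X$ is a Li-Yorke chaotic set relative to $\mathcal{F}$ if $S$ is uncountable and for any distinct $x,y\in S$: there is a sequence $\{t_n\}$ in $T$ with $\lim_{n\to\infty}d(t_nx,t_ny)=0$, and there is a sequence $\{s_n\}$ in $T$ with $s_n\in T\setminus F_n$ for all $n$ and $\liminf_{n\to\infty}d(s_nx,s_ny)>0$. $(T,X,\pi)$ is densely Li-Yorke chaotic if for every increasing sequence $\mathcal{F}$ of compact subsets of $T$ there is a Li-Yorke chaotic set relative to $\mathcal{F}$ that is dense in $X$. *)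

(* Defs.v *)
From HB Require Import structures.
From mathcomp Require Import all_boot all_order all_algebra monoid.
From mathcomp Require Import all_classical all_reals all_analysis.

Set Implicit Arguments.
Unset Strict Implicit.
Unset Printing Implicit Defensive.

Import Order.TTheory GRing.Theory Num.Theory.
Import numFieldNormedType.Exports.

Local Open Scope classical_set_scope.
Local Open Scope ring_scope.

(* No separation axiom is required. *)
HB.mixin Record Group_isTopologicalGroup T & Group T & Topological T := {
  mulg_continuous : continuous (fun st : T * T => (st.1 * st.2)%g) ;
  invg_continuous : continuous (fun t : T => (t^-1)%g)
}.

#[short(type="topologicalGroupType")]
HB.structure Definition TopologicalGroup :=
  {T of Group T & Topological T & Group_isTopologicalGroup T}.

(* [Complete] carries a base point, so the space is nonempty. *)
#[short(type="completeMetricType")]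
HB.structure Definition CompleteMetric (R : numDomainType) :=
  {X of Metric R X & Complete X}.

Definition separable (X : topologicalType) :=
  exists2 D : set X, countable D & dense D.

Record flow (T : topologicalGroupType) (X : topologicalType) := Flow {
  flow_act :> T -> X -> X ;
  flow_continuous : continuous (fun tx : T * X => flow_act tx.1 tx.2) ;
  flow_actM : forall (s t : T) (x : X),
    flow_act s (flow_act t x) = flow_act (s * t)%g x ;
  flow_act1 : forall x : X, flow_act 1%g x = x
}.

Section flow_properties.
Context {T : topologicalGroupType} {X : topologicalType} (f : flow T X).

Definition hitting_times (U V : set X) : set T :=
  [set t | U `&` f t @^-1` V !=set0].

Definition weakly_mixing := forall U V U' V' : set X,
  open U -> open V -> open U' -> open V' ->
  U !=set0 -> V !=set0 -> U' !=set0 -> V' !=set0 ->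
  hitting_times U V `&` hitting_times U' V' !=set0.

End flow_properties.

Section li_yorke.
Context {R : realType} {T : topologicalGroupType} {X : metricType R}.
Variable f : flow T X.

(* The liminf is taken in the extended reals: it is +oo when the distances
   tend to infinity. *)
Definition li_yorke_chaotic_set (F : (set T)^nat) (S : set X) :=
  ~ countable S /\
  forall x y, S x -> S y -> x <> y ->
    (exists t : T^nat, mdist (f (t n) x) (f (t n) y) @[n --> \oo] --> (0 : R)) /\
    (exists s : T^nat, (forall n, ~ F n (s n)) /\
      (0 < limn_einf (fun n => (mdist (f (s n) x) (f (s n) y))%:E))%E).

Definition densely_li_yorke_chaotic :=
  forall F : (set T)^nat,
    (forall n, F n `<=` F n.+1) -> (forall n, compact (F n)) ->
    exists2 S : set X, li_yorke_chaotic_set F S & dense S.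

End li_yorke.

(* Main.v *)
Require Import Defs.
From mathcomp Require Import all_boot all_order all_algebra.
From mathcomp Require Import all_classical all_reals all_analysis.
From mathcomp Require Import lra.

(** Two relations have to hold between any two distinct points of the scrambled
set: the points are brought arbitrarily close by the action, and, for a fixed
[d > 0] and every [n], some time outside [F n] keeps them more than [d] apart.
Each is a countable intersection of relations that are symmetric, have open
sections and meet every open rectangle.  A theorem in the style of Mycielski
([uncountable_dense_independent]) then produces an uncountable dense set whose
distinct points are all related: almost every point, in the sense of category,
is related to almost every other point, so a countable set of pairwise related
generic points can always be enlarged inside any given open set.  One such set
is made dense by an inductive construction, and Zorn's lemma extends it to a
maximal one, which cannot be countable.

Density of the proximality relations is immediate: weak mixing moves two open
sets into the same small ball at the same time.  Density of the separation
relations ([weakly_mixing_separated]) is the heart of the matter, because the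
group is not assumed commutative and the times that send [U] to [A] and [V] to
[B] may well form a relatively compact set (think of the affine group of the
line, acting on bounded intervals).  Suppose that outside a compact set [F] of
times all pairs of [U * V] stay [d]-close.  Take [(x, y)] in [U * V].  Pairs
near [(x, y)] are sent near any pair [(u, v)] at distance more than [d], and
this happens only at times of [F]; by compactness [(u, v) = (t x, t y)] for some
[t] in [F] ([compact_hitting_times]).  Hence a time [s] outside the compact set
[F F^-1] brings every pair at distance more than [d] to distance at most [d],
since [s t] is not in [F].  Comparing two close points with a third, distant
one shows that [s] maps the whole space onto a set of diameter at most [2 d].
But [s] is a bijection, so this fails as soon as [d] is small compared with the
diameter of the space.  Such an [s] exists, because the acting group is not
compact: a compact group would, by the same argument, send a diagonal pair
[(a, a)] onto a pair [(a, b)] with [a <> b]. *)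

Set Implicit Arguments.
Unset Strict Implicit.
Unset Printing Implicit Defensive.

Import Order.TTheory GRing.Theory Num.Theory.
Import numFieldNormedType.Exports.

Local Open Scope classical_set_scope.
Local Open Scope ring_scope.

(** * Open sets of a metric space *)

Section metric_facts.
Context {R : realType} {X : metricType R}.

Lemma open_mdist_ball (x : X) (e : R) : open [set y | mdist x y < e].
Proof.
rewrite openE => y /= xye.
apply/metricType_numDomainType.nbhs_mdistP.
exists (e - mdist x y) => /=; first by rewrite subr_gt0.
move=> z /=; rewrite ltrBrDl; apply: le_lt_trans; exact: metric_triangle.
Qed.

Lemma open_mdist_gt (x : X) (e : R) : open [set y | e < mdist x y].
Proof.
rewrite openE => y /= xye.
apply/metricType_numDomainType.nbhs_mdistP.
exists (mdist x y - e) => /=; first by rewrite subr_gt0.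
move=> z /= yz; have := metric_triangle x z y.
by rewrite (metric_sym z y); lra.
Qed.

Lemma open_mdistP (U : set X) (x : X) : open U -> U x ->
  exists2 e : R, 0 < e & forall y, mdist x y < e -> U y.
Proof.
move=> oU Ux; have /metricType_numDomainType.nbhs_mdistP[e e0 eU] : nbhs x U.
  exact: open_nbhs_nbhs.
by exists e.
Qed.

Lemma mdist_perturb (x y x' y' : X) :
  mdist x y <= mdist x x' + mdist x' y' + mdist y y'.
Proof.
have := metric_triangle x x' y; have := metric_triangle x' y' y.
rewrite (metric_sym y' y); lra.
Qed.

Lemma invS_small (e : R) : 0 < e -> exists n, n.+1%:R^-1 < e.
Proof.
move=> e0; exists (Num.truncn e^-1).
by rewrite -ltf_pV2 ?posrE ?invr_gt0 ?ltr0n// invrK truncnS_gt.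
Qed.

End metric_facts.

(** * Baire category in complete metric spaces *)

Section baire.
Context {R : realType} {X : completeMetricType R}.

Lemma nested_balls_meet (c : nat -> X) (r : nat -> R) :
  (forall n, 0 < r n) ->
  (forall e, 0 < e -> exists n, r n < e) ->
  (forall n z, mdist (c n.+1) z <= r n.+1 -> mdist (c n) z <= r n) ->
  exists z, forall n, mdist (c n) z <= r n.
Proof.
move=> r0 rto0 nest.
have cin n m : (n <= m)%N -> mdist (c n) (c m) <= r n.
  move=> nm; suff: forall z, mdist (c m) z <= r m -> mdist (c n) z <= r n.
    by apply; rewrite mdistxx ltW.
  elim: m nm => [|m IH]; first by rewrite leqn0 => /eqP ->.
  rewrite leq_eqVlt => /predU1P[-> //|nm] z /nest; exact: IH.
have /cvg_ex[l cl] : cvg (c @ \oo).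
  apply: cauchy_cvg; apply: cauchy_exP => e /rto0[n rn].
  exists (c n), n => // m /= nm; rewrite ballEmdist /=.
  exact: le_lt_trans (cin _ _ nm) rn.
exists l => n; apply/ler_addgt0Pr => e e0.
have [N _ Ncl] := (metricType_numDomainType.cvgrPdist_lt _ _).1 cl e e0.
have := Ncl (maxn N n) (leq_maxl _ _); have := cin n _ (leq_maxr N n).
have := metric_triangle (c n) (c (maxn N n)) l.
rewrite (metric_sym l) /=; lra.
Qed.

(** A point common to [U] and all the [F n] is the limit of the centers of
closed balls chosen so that each lies in the previous one and in [F n], the
first one lying in [U], with radii tending to zero. *)
Lemma baire_complete_metric (F : nat -> set X) :
  (forall n, open (F n)) -> (forall n, dense (F n)) ->
  dense (\bigcap_n F n).
Proof.
move=> oF dF U [u Uu] oU.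
pose inside (n : nat) (D : set X) (b : X * R) :=
  [/\ 0 < b.2, b.2 < n.+1%:R^-1 &
      forall z, mdist b.1 z <= b.2 -> D z /\ F n z].
have shrink n (D : set X) : open D -> D !=set0 -> exists b, inside n D b.
  move=> oD D0; have [c [Dc Fc]] := dF n D D0 oD.
  have [e e0 ce] := open_mdistP (openI oD (oF n)) (conj Dc Fc).
  exists (c, Num.min (e / 2) (n.+2%:R^-1)); split => /=.
  - by rewrite lt_min divr_gt0// invr_gt0 ltr0n.
  - by rewrite gt_min ltf_pV2 ?posrE// ltr_nat leqnn orbT.
  - move=> z; rewrite le_min => /andP[cz _]; apply: ce.
    by apply: le_lt_trans cz _; lra.
(* One step is a total function of the current ball; it is only meaningful
   on balls of positive radius. *)
have /choice[next nextP] (p : nat * (X * R)) : exists b, 0 < p.2.2 ->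
    inside p.1.+1 [set z | mdist p.2.1 z < p.2.2] b.
  have [r0|r0] := ltP 0 p.2.2; last by exists p.2.
  have [|b bP] := shrink p.1.+1 _ (open_mdist_ball p.2.1 p.2.2); last by exists b.
  by exists p.2.1; rewrite /= mdistxx.
have [b0 [b0_gt0 b0_lt b0P]] := shrink 0%N U oU (ex_intro _ u Uu).
pose fix b n := if n is m.+1 then next (m, b m) else b0.
have b_gt0 n : 0 < (b n).2 by elim: n => //= n /(nextP (n, b n))[].
have bS n := nextP (n, b n) (b_gt0 n).
have [|||z zb] := @nested_balls_meet (fst \o b) (snd \o b) => //.
- move=> e /invS_small[n ne]; exists n.+1.
  have [_ /lt_trans + _] := bS n; apply; apply: lt_trans ne.
  by rewrite ltf_pV2 ?posrE// ltr_nat.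
- by move=> n z /=; have [_ _ /(_ z)] := bS n => + zb => /(_ zb)[/ltW].
exists z; split; first by have [] := b0P z (zb 0%N).
by move=> [|n] _; [have [] := b0P z (zb 0%N) | have [_ _ /(_ z (zb n.+1))[]] := bS n].
Qed.

End baire.

Section comeager_def.
Context {X : topologicalType}.

(** A set of open dense sets, rather than a sequence of them, makes comeager
sets closed under countable intersections without any reindexing. *)
Definition comeager (B : set X) := exists G : set (set X),
  [/\ countable G, forall U, G U -> open U /\ dense U &
      \bigcap_(U in G) U `<=` B].

Lemma comeagerS (B C : set X) : B `<=` C -> comeager B -> comeager C.
Proof. by move=> BC [G [cG oG GB]]; exists G; split=> //; exact: subset_trans GB BC. Qed.

Lemma comeager_open_dense (U : set X) : open U -> dense U -> comeager U.
Proof.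
by move=> oU dU; exists [set U]; split=> [//|_ -> //|]; rewrite bigcap_set1.
Qed.

Lemma comeager_bigcap (I : Type) (D : set I) (B : I -> set X) :
  countable D -> (forall i, D i -> comeager (B i)) ->
  comeager (\bigcap_(i in D) B i).
Proof.
move=> cD cB.
have /choice[G GP] (i : I) : exists G : set (set X), D i ->
  [/\ countable G, forall U, G U -> open U /\ dense U &
      \bigcap_(U in G) U `<=` B i].
  by have [/cB[G]|nDi] := pselect (D i); [exists G | exists set0].
exists (\bigcup_(i in D) G i); split.
- by apply: bigcup_countable => // i /GP[].
- by move=> U [i /GP[_ + _] GU]; exact.
- move=> x xG i Di; have [_ _] := GP i Di; apply => U GU.
  by apply: xG; exists i.
Qed.

Lemma comeagerI (B C : set X) : comeager B -> comeager C -> comeager (B `&` C).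
Proof.
move=> cB cC.
have : comeager (\bigcap_(b in [set: bool]) if b then B else C).
  by apply: comeager_bigcap => // -[].
by apply: comeagerS => x BC; split; [exact: (BC true) | exact: (BC false)].
Qed.

End comeager_def.

Lemma comeager_dense {R : realType} {X : completeMetricType R} (B : set X) :
  comeager B -> dense B.
Proof.
move=> [G [/countable_injP[f finj] oG GB]] U U0 oU.
(* The n-th term is the member of G coded by n, or the whole space if there
   is none; this also covers an empty G. *)
pose F n : set X := [set x | forall V, G V -> f V = n -> V x].
have FE n : F n = setT \/ G (F n).
  have [[V [GV fV]]|noV] := pselect (exists V, G V /\ f V = n); [right|left].
    suff -> : F n = V by [].
    apply/seteqP; split => [x|x Vx W GW fW]; first exact.
    by rewrite (finj W V) ?inE// fW fV.
  by rewrite -subTset => x _ V GV fV; case: noV; exists V.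
have [||x [Ux xF]] := @baire_complete_metric R X F _ _ U U0 oU.
- by move=> n; case: (FE n) => [->|/oG[]//]; exact: openT.
- move=> n; case: (FE n) => [->|/oG[]//].
  by move=> V [v Vv] _; exists v.
by exists x; split=> //; apply: GB => V GV; exact: (xF (f V) I V GV).
Qed.

(** * Large sets of pairwise related points *)

Definition rectangle_dense {X : topologicalType} (G : X -> X -> Prop) :=
  forall U V : set X, open U -> open V -> U !=set0 -> V !=set0 ->
  exists x y, [/\ U x, V y & G x y].

Section independent_sets.
Context {R : realType} {X : completeMetricType R}.
Context (sepX : separable X).

Lemma separable_small_balls : exists B : set (set X),
  [/\ countable B, forall V, B V -> open V /\ V !=set0 &
      forall U : set X, open U -> U !=set0 -> exists2 V, B V & V `<=` U].
Proof.
have [D cD dD] := sepX.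
have [r r0 rsmall] : exists2 r : nat -> R, forall n, 0 < r n &
    forall e, 0 < e -> exists n, r n < e.
  exists (fun n => n.+1%:R^-1) => [n|e e0]; first by rewrite invr_gt0 ltr0n.
  exact: invS_small.
pose V (dn : X * nat) : set X := [set y | mdist dn.1 y < r dn.2].
exists (\bigcup_(dn in D `*` setT) [set V dn]); split.
- by apply: bigcup_countable => //; exact: countableX.
- move=> _ [dn _ ->]; split; first exact: open_mdist_ball.
  by exists dn.1; rewrite /V /= mdistxx.
move=> U oU [u Uu]; have [e e0 eU] := open_mdistP oU Uu.
have [|n ne] := rsmall (e / 2); first by rewrite divr_gt0.
have [||d [ud Dd]] := dD [set y | mdist u y < r n].
- by exists u; rewrite /= mdistxx.
- exact: open_mdist_ball.
exists (V (d, n)); first by exists (d, n).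
move=> y; rewrite /V /= in ud * => dy; apply: eU.
have := metric_triangle u d y; lra.
Qed.

(** The Kuratowski-Ulam theorem for one open dense relation: the section at [x]
is dense when it meets every set of a countable family of open sets that
refines all the others, and each of these countably many conditions on [x] is
open and dense. *)
Lemma comeager_sections (G : X -> X -> Prop) :
  (forall x y, G x y -> G y x) -> (forall x, open [set y | G x y]) ->
  rectangle_dense G -> comeager [set x | comeager [set y | G x y]].
Proof.
move=> Gsym oG dG; have [B [cB oB smallB]] := separable_small_balls.
pose W V := [set x | exists2 y, V y & G x y].
have : comeager (\bigcap_(V in B) W V).
  apply: comeager_bigcap => // V /oB[oV V0]; apply: comeager_open_dense.
    rewrite (_ : W V = \bigcup_(y in V) [set x | G y x]).
      exact: bigcup_open.
    by apply/seteqP; split => x [y Vy /Gsym Gxy]; exists y.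
  move=> U U0 oU; have [x [y [Ux Vy Gxy]]] := dG U V oU oV U0 V0.
  by exists x; split => //; exists y.
apply: comeagerS => x xW; apply: comeager_open_dense => // U U0 oU.
have [V BV VU] := smallB U oU U0; have [y Vy Gxy] := xW V BV.
by exists y; split => //; exact: VU.
Qed.

Context (perfX : forall x : X, ~ open [set x]).

Lemma comeager_setC1 (x : X) : comeager (~` [set x]).
Proof.
apply: comeager_open_dense.
  rewrite openC; apply: accessible_closed_set1.
  exact/hausdorff_accessible/metric_hausdorff.
move=> U [u Uu] oU; apply: contrapT => noU; apply: (perfX (x := x)).
suff -> : [set x] = U by [].
have Ux y : U y -> y = x.
  by move=> Uy; apply: contrapT => yx; apply: noU; exists y.
by apply/seteqP; split => [_ ->|//]; rewrite -(Ux u Uu).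
Qed.

Context (J : countType) (G : J -> X -> X -> Prop).
Context (Gsym : forall i x y, G i x y -> G i y x).
Context (Gopen : forall i x, open [set y | G i x y]).
Context (Gdense : forall i, rectangle_dense (G i)).

Definition related x y := forall i, G i x y.

Definition generic := [set x | comeager [set y | related x y]].

(** Points are required to be generic so that an independent countable set can
always be enlarged. *)
Definition independent (S : set X) :=
  S `<=` generic /\ forall x y, S x -> S y -> x <> y -> related x y.

Lemma comeager_generic : comeager generic.
Proof.
have : comeager (\bigcap_(i in [set: J]) [set x | comeager [set y | G i x y]]).
  apply: comeager_bigcap => // i _.
  exact: comeager_sections (@Gsym i) (@Gopen i) (@Gdense i).
apply: comeagerS => x xG.
have : comeager (\bigcap_(i in [set: J]) [set y | G i x y]).
  by apply: comeager_bigcap => // i _; exact: (xG i I).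
by apply: comeagerS => y xyG i; exact: (xyG i I).
Qed.

(** The conditions on the new point, one for each point of [S] together with
genericity, are countably many comeager ones, so Baire's theorem applies. *)
Lemma independent_extend (S U : set X) : countable S -> independent S ->
  open U -> U !=set0 ->
  exists z, [/\ U z, ~ S z & independent (S `|` [set z])].
Proof.
move=> cS [Sgen Srel] oU U0.
have /comeager_dense/(_ U U0 oU)[z [Uz [gz Sz]]] : comeager (generic `&`
    \bigcap_(x in S) ([set y | related x y] `&` ~` [set x])).
  apply: comeagerI comeager_generic _; apply: comeager_bigcap => // x Sx.
  by apply: comeagerI; [exact: Sgen|exact: comeager_setC1].
exists z; split => //.
  by move=> zS; have [_] := Sz z zS; apply.
split=> [x [/Sgen//|->//]|x y [Sx|->] [Sy|->] xy //].
- exact: Srel.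
- by have [] := Sz x Sx.
- by move=> i; apply: Gsym; have [+ _] := Sz y Sy; exact.
Qed.

Lemma independent_bigcup_chain (K : set (set X)) :
  K `<=` independent -> total_on K subset -> independent (\bigcup_(S in K) S).
Proof.
move=> Kind Ktot; split=> [x [S /Kind[Sgen _]]|x y [S KS Sx] [S' KS' Sy]].
  exact: Sgen.
have [SS'|S'S] := Ktot S S' KS KS'.
- by apply: (Kind S' KS').2 => //; exact: SS'.
- by apply: (Kind S KS).2 => //; exact: S'S.
Qed.

Lemma countable_dense_independent :
  exists S : set X, [/\ countable S, independent S & dense S].
Proof.
have [B [/countable_injP[code codeI] oB smallB]] := separable_small_balls.
(* Step n adds a point of the open set coded by n, if there is one. *)
have /choice[ext extP] (p : nat * set X) : exists S : set X,
    countable p.2 /\ independent p.2 ->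
    [/\ countable S /\ independent S, p.2 `<=` S &
        forall V, B V -> code V = p.1 -> (V `&` S) !=set0].
  case: p => n S /=.
  have [[cS iS]|?] := pselect (countable S /\ independent S); last by exists S.
  have [[V [BV Vn]]|noV] := pselect (exists V, B V /\ code V = n); last first.
    by exists S => _; split => // V BV Vn; case: noV; exists V.
  have [oV V0] := oB V BV; have [z [Vz _ iz]] := independent_extend cS iS oV V0.
  exists (S `|` [set z]) => _; split; last 2 first.
  - by move=> x; left.
  - move=> V' BV' V'n; exists z; split; last by right.
    by rewrite (codeI V' V) ?inE// V'n Vn.
  split => //; rewrite -bigcup2E; apply: bigcup_countable => // -[|[|k]] _ //=.
pose fix C n := if n is m.+1 then ext (m, C m) else set0.
have CP n : countable (C n) /\ independent (C n).
  elim: n => [|n IH] /=; first by split; [exact: countable0 | split].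
  by have [] := extP (n, C n) IH.
have Cmono n m : (n <= m)%N -> C n `<=` C m.
  elim: m => [|m IH]; first by rewrite leqn0 => /eqP ->.
  rewrite leq_eqVlt => /predU1P[-> //|/IH nm]; apply: subset_trans nm _.
  by have [] := extP (m, C m) (CP m).
exists (\bigcup_(S in range C) S); split.
- apply: bigcup_countable; last by move=> _ [n _ <-]; case: (CP n).
  by rewrite -bigcup_imset1; apply: bigcup_countable.
- apply: independent_bigcup_chain => [_ [n _ <-]|_ _ [n _ <-] [m _ <-]].
    by case: (CP n).
  by have [/Cmono|/ltnW/Cmono] := leqP n m; [left|right].
move=> U U0 oU; have [V BV VU] := smallB U oU U0.
have [_ _ /(_ V BV erefl)[z [Vz Cz]]] := extP (code V, C (code V)) (CP _).
by exists z; split; [exact: VU | exists (C (code V).+1) => //; exists (code V).+1].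
Qed.

(** A maximal independent set containing a dense one is uncountable, since a
countable one could be enlarged. *)
Theorem uncountable_dense_independent : exists S : set X,
  [/\ ~ countable S, dense S &
      forall x y, S x -> S y -> x <> y -> forall i, G i x y].
Proof.
have [S0 [_ iS0 dS0]] := countable_dense_independent.
have [K Kind Ktot|S1 [iS1 maxS1]] := @Zorn_bigcup X [set S | independent (S0 `|` S)].
  (* Adding S0 to the chain takes care of the empty chain. *)
  pose K0 := [set S0] `|` (setU S0 @` K).
  have -> /= : [set S | independent (S0 `|` S)] (\bigcup_(S in K) S) =
      independent (\bigcup_(S in K0) S).
    congr independent; apply/seteqP; split=> [x [S0x|[S KS Sx]]|x [_ [->|[S KS <-]]]].
    - by exists S0 => //; left.
    - by exists (S0 `|` S); [right; exists S|right].
    - by left.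
    - by move=> [S0x|Sx]; [left|right; exists S].
  apply: independent_bigcup_chain => [_ [->//|[S /Kind iS <-]//]|].
  move=> _ _ [->|[S KS <-]] [->|[S' KS' <-]]; [by left | by left | by right|].
  by have [SS'|S'S] := Ktot S S' KS KS'; [left|right]; exact: setUS.
exists (S0 `|` S1); split.
- move=> cS; have [z [_ Sz iSz]] := independent_extend cS iS1 openT (ex_intro _ point I).
  apply: (maxS1 (S1 `|` [set z])); last by rewrite /= setUA.
  split; first by move=> x; left.
  by move=> /(_ z (or_intror erefl)) S1z; apply: Sz; right.
- by move=> U U0 oU; have [z [Uz Sz]] := dS0 U U0 oU; exists z; split => //; left.
- exact: iS1.2.
Qed.

End independent_sets.

(** * Flows and compact sets of times *)

Section flows.
Context {T : topologicalGroupType}.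

Lemma act_continuous {X : topologicalType} (f : flow T X) (t : T) :
  continuous (f t).
Proof.
move=> x; apply: (@continuous_comp _ _ _ (fun y => (t, y)) (fun p => f p.1 p.2)).
  by apply: cvg_pair => //; exact: cvg_cst.
exact: (@flow_continuous _ _ f).
Qed.

Lemma actV {X : topologicalType} (f : flow T X) (t : T) (x : X) :
  f t (f (t^-1)%g x) = x.
Proof. by rewrite flow_actM mulgV flow_act1. Qed.

Lemma compact_mulgV (F : set T) : compact F ->
  compact [set (p.1 * p.2^-1)%g | p in F `*` F].
Proof.
move=> cF; apply: continuous_compact; last exact: compact_setX.
apply: continuous_subspaceT => p.
apply: (@continuous_comp _ _ _ (fun p : T * T => (p.1, p.2^-1)%g)
  (fun p => p.1 * p.2)%g); last exact: mulg_continuous.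
apply: cvg_pair; first exact: cvg_fst.
apply: (@continuous_comp _ _ _ snd (fun t : T => t^-1)%g); first exact: cvg_snd.
exact: invg_continuous.
Qed.

(** If times of a compact set send points arbitrarily near [x] and [y] to points
arbitrarily near [u] and [v], then one of these times sends [x] and [y] exactly
to [u] and [v].  Otherwise each time of [F] has a neighborhood on which small
neighborhoods of the four points rule out any hit, and finitely many of these
neighborhoods cover [F]. *)
Lemma compact_hitting_times {X : topologicalType} (f : flow T X) (F : set T)
    (x y u v : X) : hausdorff_space X -> compact F ->
  (forall U V N M, open_nbhs x U -> open_nbhs y V ->
     open_nbhs u N -> open_nbhs v M ->
     exists t, [/\ F t, hitting_times f U N t & hitting_times f V M t]) ->
  exists t, [/\ F t, f t x = u & f t y = v].
Proof.
move=> hX /compact_near_coveringP cF hit; apply: contrapT => noF.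
have sep (t : T) (x0 u0 : X) : f t x0 <> u0 ->
    \forall s \near t & p \near (x0, u0), f s p.1 <> p.2.
  move=> /eqP txu; have := hX.
  rewrite open_hausdorff => /(_ _ _ txu)[[A B] /=].
  move=> [/set_mem Atx /set_mem Bu] [oA oB /eqP AB0].
  have [[S U] /= [tS xU] SUA] : nbhs (t, x0) [set p | A (f p.1 p.2)].
    apply: (@flow_continuous _ _ f (t, x0)); exact: (open_nbhs_nbhs (conj oA Atx)).
  exists (S, U `*` B) => /=.
    by split => //; exists (U, B) => //=; split => //; exact: open_nbhs_nbhs.
  move=> [s [x' u']] /= [Ss [Ux' Bu']] sxu.
  have : (A `&` B) u' by split => //; rewrite -sxu; exact: (SUA (s, x')).
  by rewrite AB0.
have := cF ((X * X) * (X * X))%type (nbhs ((x, u), (y, v)))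
  (fun p t => ~ (f t p.1.1 = p.1.2 /\ f t p.2.1 = p.2.2)) _.
case=> [t Ft|[P Q] /= [[[U N] /= [xU uN] UNP] [[V M] /= [yV vM] VMQ]] PQ].
  have [txu|/sep [[S P] /= [tS xuP] SP]] := pselect (f t x = u).
    have /sep[[S Q] /= [tS yvQ] SQ] : f t y <> v by move=> tyv; apply: noF; exists t.
    exists (S, setT `*` Q) => /=.
      by split => //; exists (setT, Q) => //; split => //; exact: filterT.
    by move=> [s [p q]] /= [Ss [_ Qq]] [_ /(SQ (s, q) (conj Ss Qq))].
  exists (S, P `*` setT) => /=.
    by split => //; exists (P, setT) => //; split => //; exact: filterT.
  by move=> [s [p q]] /= [Ss [Pp _]] [/(SP (s, p) (conj Ss Pp))].
have inter (z : X) (A : set X) : nbhs z A -> open_nbhs z A^°.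
  by move=> zA; split; [exact: open_interior|exact: nbhs_singleton (nbhs_interior zA)].
have [t [Ft [x' [/interior_subset Ux' /interior_subset Nx']]
          [y' [/interior_subset Vy' /interior_subset My']]]] :=
  hit _ _ _ _ (inter _ _ xU) (inter _ _ yV) (inter _ _ uN) (inter _ _ vM).
apply: (PQ ((x', f t x'), (y', f t y'))) Ft _ => //.
by split; [exact: UNP|exact: VMQ].
Qed.

End flows.

(** * Weak mixing *)

Section weak_mixing.
Context {R : realType} {T : topologicalGroupType} {X : metricType R}.
Context (f : flow T X) (wm : weakly_mixing f).

(** A time at which an isolated point [p] returns to [{p}] fixes [p], so it
cannot also send [p] to a neighborhood of another point. *)
Lemma weakly_mixing_no_isolated (a b : X) : a <> b ->
  forall p : X, ~ open [set p].
Proof.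
move=> ab p op.
suff all_p q : p = q by apply: ab; rewrite -(all_p a) -(all_p b).
apply/mdist_positivity/eqP; apply: contrapT => /negP pq.
have pq0 : 0 < mdist q p by rewrite lt_def mdist_ge0 metric_sym pq.
have p1 : [set p] !=set0 by exists p.
have [|t [[_ [-> /= tp]] [_ [-> /=]]]] :=
    wm op op op (open_mdist_ball q (mdist q p)) p1 p1 p1.
  by exists q; rewrite /= mdistxx.
by rewrite tp ltxx.
Qed.

Lemma weakly_mixing_proximal (e : R) : 0 < e ->
  rectangle_dense (fun x y => exists t, mdist (f t x) (f t y) < e).
Proof.
move=> e0 U V oU oV U0 V0; have [u _] := U0.
pose W := [set y | mdist u y < e / 2].
have oW : open W by exact: open_mdist_ball.
have W0 : W !=set0 by exists u; rewrite /W /= mdistxx divr_gt0.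
have [t [[x [Ux Wx]] [y [Vy Wy]]]] := wm oU oW oV oW U0 W0 V0 W0.
exists x, y; split => //; exists t; rewrite /W /= in Wx Wy.
have := metric_triangle (f t x) u (f t y).
by rewrite (metric_sym (f t x) u); lra.
Qed.

(** With all times in a compact set, some time would send the single point [a]
both to [a] and to [b]. *)
Lemma weakly_mixing_not_compact (a b : X) : a <> b -> ~ compact [set: T].
Proof.
move=> ab cT.
have [U V N M [oU Ux] [oV Vx] [oN Nx] [oM Mx]|t [_ ta tb]] :=
  @compact_hitting_times _ _ f setT a a a b (@metric_hausdorff _ X) cT;
  last by apply: ab; rewrite -ta.
have [||||t [tUN tVM]] := wm oU oN oV oM; last by exists t.
all: by [exists a|exists b].
Qed.

(** If it failed on [U * V], a time outside [F F^-1] would shrink the whole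
space to diameter [2 d], although it acts as a bijection. *)
Lemma weakly_mixing_separated (d : R) (a b : X) (F : set T) :
  0 < d -> 4 * d < mdist a b -> compact F ->
  rectangle_dense (fun x y => exists2 s, ~ F s & d < mdist (f s x) (f s y)).
Proof.
move=> d0 dab cF U V oU oV [x Ux] [y Vy]; apply: contrapT => noxy.
have close x' y' s : U x' -> V y' -> ~ F s -> mdist (f s x') (f s y') <= d.
  move=> Ux' Vy' Fs; rewrite leNgt; apply/negP => far.
  by apply: noxy; exists x', y'; split => //; exists s.
have reach u v : d < mdist u v -> exists t, [/\ F t, f t x = u & f t y = v].
  move=> duv; apply: compact_hitting_times cF _; first exact: metric_hausdorff.
  move=> U' V' N M [oU' U'x] [oV' V'y] [oN Nu] [oM Mv].
  pose e := (mdist u v - d) / 2.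
  have e0 : 0 < e by rewrite divr_gt0// subr_gt0.
  have [||||t [[x' [[U'x' Ux'] [Nx' ux']]] [y' [[V'y' Vy'] [My' vy']]]]] :=
    wm (openI oU' oU) (openI oN (open_mdist_ball u e))
       (openI oV' oV) (openI oM (open_mdist_ball v e)).
  - by exists x.
  - by exists u; rewrite /= mdistxx.
  - by exists y.
  - by exists v; rewrite /= mdistxx.
  exists t; split; [|by exists x'|by exists y'].
  apply: contrapT => /(close x' y' t Ux' Vy').
  have := mdist_perturb u v (f t x') (f t y').
  rewrite /= /e in ux' vy' *; lra.
have [s Fs] : exists s, ~ [set (p.1 * p.2^-1)%g | p in F `*` F] s.
  apply: contrapT => noS; have ab : a <> b.
    by move=> ab; move: dab; rewrite ab mdistxx; lra.
  apply: (weakly_mixing_not_compact ab).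
  rewrite (_ : setT = [set (p.1 * p.2^-1)%g | p in F `*` F]); first exact: compact_mulgV.
  by apply/esym; rewrite -subTset => s _; apply: contrapT => Fs; apply: noS; exists s.
have contract u v : d < mdist u v -> mdist (f s u) (f s v) <= d.
  move=> /reach[t [Ft <- <-]]; rewrite !flow_actM; apply: close => // Fst.
  by apply: Fs; exists ((s * t)%g, t) => //=; rewrite mulgK.
have image_small u v : mdist (f s u) (f s v) <= 2 * d.
  have [duv|/contract] := leP (mdist u v) d; last lra.
  (* Were every point within 2 d of u, then mdist a b would be at most 4 d. *)
  have [w [uw vw]] : exists w, d < mdist u w /\ d < mdist v w.
    apply: contrapT => noW.
    have near_uv w : mdist u w <= 2 * d.
      rewrite leNgt; apply/negP => uw; apply: noW; exists w.
      by have := metric_triangle u v w; lra.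
    have := metric_triangle a u b; have := near_uv a; have := near_uv b.
    by rewrite (metric_sym a u); lra.
  have := metric_triangle (f s u) (f s w) (f s v).
  have := contract _ _ uw; have := contract _ _ vw.
  by rewrite (metric_sym (f s v)); lra.
by have := image_small (f (s^-1)%g a) (f (s^-1)%g b); rewrite !actV; lra.
Qed.

End weak_mixing.

(** * Dense Li-Yorke chaos *)

Lemma limn_einf_ge {R : realType} (u : (\bar R)^nat) (c : \bar R) :
  (forall n, c <= u n)%E -> (c <= limn_einf u)%E.
Proof.
move=> cu; rewrite limn_einf_lim; apply: lime_ge; first exact: is_cvg_einfs.
by apply: nearW => n; apply: le_ereal_inf_tmp => _ [m _ <-].
Qed.

Theorem proposition3p21 (R : realType) (T : topologicalGroupType)
    (X : completeMetricType R) (f : flow T X) :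
  separable X ->
  (exists x y : X, x <> y) ->
  weakly_mixing f ->
  densely_li_yorke_chaotic f.
Proof.
move=> sepX [a [b ab]] wm F _ cF.
pose d := mdist a b / 5.
have d0 : 0 < d by rewrite divr_gt0// mdist_gt0; exact/eqP.
pose G (i : nat + nat) (x y : X) := match i with
  | inl n => exists t, mdist (f t x) (f t y) < n.+1%:R^-1
  | inr n => exists2 s, ~ F n s & d < mdist (f s x) (f s y) end.
have [|||S [uS dS GS]] := @uncountable_dense_independent R X sepX
  (weakly_mixing_no_isolated wm ab) (nat + nat)%type G.
- by move=> [n|n] x y [t]; [exists t|exists t => //]; rewrite metric_sym.
- have opre t (V : set X) : open V -> open (f t @^-1` V).
    by move: V; apply/continuousP; exact: act_continuous.
  move=> [n|n] x /=.
    rewrite (_ : mkset _ = \bigcup_t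
        f t @^-1` [set y | mdist (f t x) y < n.+1%:R^-1]).
      by apply: bigcup_open => t _; apply: opre; exact: open_mdist_ball.
    by apply/seteqP; split=> y [t]; [exists t|exists t].
  rewrite (_ : mkset _ = \bigcup_(s in ~` F n)
      f s @^-1` [set y | d < mdist (f s x) y]).
    by apply: bigcup_open => s _; apply: opre; exact: open_mdist_gt.
  by [].
- move=> [n|n].
    by apply: weakly_mixing_proximal => //; rewrite invr_gt0 ltr0n.
  by apply: (@weakly_mixing_separated _ _ _ _ wm d a b) => //; move: d0; rewrite /d; lra.
exists S => //; split => // x y Sx Sy xy; have Gxy := GS x y Sx Sy xy; split.
  have /choice[t tP] n := Gxy (inl n).
  exists t; apply: (squeeze_cvgr _ (cvg_cst _) cvg_harmonic).
  by apply: nearW => n; rewrite mdist_ge0 ltW.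
have /choice[s sP] (n : nat) : exists s, ~ F n s /\ d < mdist (f s x) (f s y).
  by have [s] := Gxy (inr n); exists s.
exists s; split=> [n|]; first by case: (sP n).
apply: (@lt_le_trans _ _ d%:E); first by rewrite lte_fin.
by apply: limn_einf_ge => n; rewrite lee_fin ltW//; case: (sP n).
Qed.
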